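(* Let $N\ge2$, $\delta=1/N$, and consider the differential equation $$\dot\rho_\kappa=-2\,\Delta^\delta_\kappa\Big(\frac{\sqrt{\rho_+\rho_-}-\rho}{\delta^2}\Big)\qquad(\kappa\in[N])\tag{$*$}$$ on $\mathcal P^\delta_{>0}$. The functional $\mathcal L^\delta(\rho):=-\delta\sum_\kappa\log\rho_\kappa$ is non-increasing along positive solutions $\rho$ of $( * )$ and satisfies $$\mathcal L^\delta(\rho(t))+\frac12\int_0^t\delta\sum_\kappa\big|\Delta^\delta_\kappa\log\rho(s)\big|^2ds\le\mathcal L^\delta(\rho(0))\qquad\text{for any }t>0.$$ Consequently, for each $\rho(0)\in\mathcal P^\delta_{>0}$ there is a unique positive solution $\rho:[0,\infty)\to\mathcal P^\delta_{>0}$ to $( * )$, and it satisfies the a priori bound $$\int_0^t\sup_{\kappa,\lambda\in[N]}\big|\log\rho_\kappa(s)-\log\rho_\lambda(s)\big|^2ds\le\frac{C_{\rm PI}}2\,\mathcal L^\delta(\rho(0))\qquad\text{for any }t>0,$$ where $C_{\rm PI}=\dfrac{\delta^2}{2(1-\cos(2\pi\delta))}$.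
   Context: $[N]=\mathbb Z/N\mathbb Z$ with cyclic indices. For $f:[N]\to\mathbb R$: $(f_\pm)_\kappa=f_{\kappa\pm1}$ and $\Delta^\delta f=(f_++f_--2f)/\delta^2$, with value $\Delta^\delta_\kappa f$ at $\kappa$; products, square roots and logarithms are componentwise. $\mathcal P^\delta_{>0}=\{\rho:[N]\to\mathbb R:\rho_\kappa>0\ \forall\kappa,\ \delta\sum_\kappa\rho_\kappa=1\}$. A positive solution is one with values in $\mathcal P^\delta_{>0}$. ($C_{\rm PI}$ is the constant of the discrete Poincaré inequality $\delta\sum_\kappa f_\kappa^2\le C_{\rm PI}\,\delta\sum_\kappa|(f_{\kappa+1}-f_\kappa)/\delta|^2$ for zero-average $f:[N]\to\mathbb R$.) *)

(* Defs.v *)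
From HB Require Import structures.
From mathcomp Require Import all_boot all_order all_algebra.
From mathcomp Require Import all_classical all_reals all_analysis.
Set Implicit Arguments.
Unset Strict Implicit.
Unset Printing Implicit Defensive.
Import Order.TTheory GRing.Theory Num.Theory.
Import numFieldNormedType.Exports.
Local Open Scope classical_set_scope.
Local Open Scope ring_scope.

(* [N] = Z/NZ is 'Z_N, so that k + 1 and k - 1 are the cyclic neighbours of k.
   'Z_N has exactly N elements only when 1 < N, which is assumed wherever
   these definitions are used. *)

Definition mesh (R : realType) (N : nat) : R := N%:R^-1.

Definition dlap (R : realType) (N : nat) (f : 'Z_N -> R) (k : 'Z_N) : R :=
  (f (k + 1) + f (k - 1) - 2 * f k) / mesh R N ^+ 2.

Definition pos_density (R : realType) (N : nat) (r : 'Z_N -> R) : Prop :=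
  (forall k, 0 < r k) /\ mesh R N * \sum_k r k = 1.

Definition dlss_field (R : realType) (N : nat) (r : 'Z_N -> R) (k : 'Z_N) : R :=
  - 2 * dlap (fun j => (Num.sqrt (r (j + 1) * r (j - 1)) - r j)
                       / mesh R N ^+ 2) k.

(* Positive solution on [0, T[, with T = +oo allowed.  The equation is imposed
   at every time of [0, T[: with the two-sided derivative for t > 0 and the
   right derivative at t = 0.  The values of rho outside [0, T[ are
   irrelevant. *)
Definition positive_solution (R : realType) (N : nat) (T : \bar R)
    (rho : R -> 'Z_N -> R) : Prop :=
  [/\ forall t : R, 0 <= t -> (t%:E < T)%E -> pos_density (rho t),
      forall k, h^-1 * (rho h k - rho 0 k) @[h --> 0^'+]
                  --> dlss_field (rho 0) k &
      forall (t : R) k, 0 < t -> (t%:E < T)%E ->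
        is_derive t (1 : R) (fun s => rho s k) (dlss_field (rho t) k)].

Definition log_functional (R : realType) (N : nat) (r : 'Z_N -> R) : R :=
  - (mesh R N * \sum_k ln (r k)).

Definition log_dissipation (R : realType) (N : nat) (r : 'Z_N -> R) : R :=
  mesh R N * \sum_k `|dlap (fun j => ln (r j)) k| ^+ 2.

(* The supremum of a nonempty finite set, hence a maximum. *)
Definition log_osc2 (R : realType) (N : nat) (r : 'Z_N -> R) : R :=
  sup [set x : R | exists k l : 'Z_N, x = `|ln (r k) - ln (r l)| ^+ 2].

(* The constant of the discrete Poincare inequality
   d * sum_k f_k^2 <= C * d * sum_k |(f_(k+1) - f_k) / d|^2
   for f of zero average, where d = mesh R N. *)
Definition C_PI (R : realType) (N : nat) : R :=
  mesh R N ^+ 2 / (2 * (1 - cos (2 * pi * mesh R N))).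

(* Main.v *)
Require Import Defs.
From HB Require Import structures.
From mathcomp Require Import all_boot all_order all_algebra.
From mathcomp Require Import all_classical all_reals all_analysis.
From mathcomp Require Import measurable_realfun ring lra.
Import Order.TTheory GRing.Theory Num.Theory.
Import numFieldNormedType.Exports.
Local Open Scope classical_set_scope.
Local Open Scope ring_scope.

(** Dissipation.  Along a positive solution, summation by parts gives
    [d/dt log_functional = - mesh * sum_k (dlss_field rho k / rho k)].  Write
    [s = sqrt rho], [x_k = s_(k+1) / s_k] and [y_k = s_k / s_(k-1) = x_(k-1)].
    Up to the factor [-2 / mesh^4] and shifts of the summation index, the
    summand becomes
    [- (x-y)^2/2 - (1/x-1/y)^2/2 + 2 - 2x/y].  With [v = x/y] the two squares
    are worth at least [v + 1/v - 2 >= (ln v)^2], and [2 - 2v <= - 2 ln v],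
    whose sum over the cycle telescopes to zero.  As [ln v] is half the second
    difference of [ln rho], what is left is exactly half of the dissipation
    ([entropy_production]).  Integrating in time gives [energy_dissipation].

    Global solutions.  Jensen's inequality makes [log_functional] nonnegative
    on densities, and a bound on it keeps every component of a density above a
    positive constant ([pos_density_ge]).  Replace the vector field by the one
    obtained by first clamping each component to an interval [[c, N]], with [c]
    half of that constant: it is globally Lipschitz, so the Picard iteration,
    run in the weighted norm [sup_t exp(-2Kt) |x t|] where it halves distances,
    produces a solution for all times ([picard_lindelof]).  Before the first
    time at which a component falls below [c] the clamping is inactive, so the
    dissipation estimate holds and bounds the components by [2c] from below;
    hence that time never comes ([flow_floor]).  Any other positive solution
    obeys the same lower bound, thus solves the clamped equation as well, and
    the contraction estimate identifies the two ([solution_unique]).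

    A priori bound.  Two points split the cycle into two arcs, so the
    oscillation of [g = ln rho] is at most half of its total variation; by the
    Cauchy-Schwarz and Poincare inequalities, the latter applied to the
    difference of [g], the square of the oscillation is at most [C_PI / 4] times
    the dissipation ([log_osc2_le]).  The sharp Poincare constant comes from the
    discrete Fourier transform, which multiplies the energy of mode [j] by
    [2 - 2 cos (2 pi j / N)] when differences are taken. *)

Set Implicit Arguments.
Unset Strict Implicit.
Unset Printing Implicit Defensive.

(** * Entropy production of the spatial discretization *)

(** With [y = exp u] this is [u^2 <= 4 sinh^2 (u/2)]: for [u >= 0] the square of
    [u <= 2 sinh (u/2)], and both sides are even in [u]. *)
Lemma sqr_ln_le (R : realType) (y : R) : 0 < y -> ln y ^+ 2 <= y + y^-1 - 2.
Proof.
(* z - 1/z - 2 ln z vanishes at 1 and has derivative (1 - 1/z)^2 *)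
have sinh_ge (z : R) : 1 <= z -> 2 * ln z <= z - z^-1.
  move=> z1.
  pose g := fun x : R => x - x^-1 - 2 * ln x.
  have dg (x : R) : 1 <= x -> is_derive x 1 g (1 + x^-1 ^+ 2 - 2 * x^-1).
    move=> x1; have x0 : 0 < x by apply: lt_le_trans x1.
    have h1 := is_derive1_ln x0.
    have h2 : x != 0 by rewrite gt_eqF.
    have h3 := is_deriveV h2 (is_derive_id x 1).
    rewrite /g; apply: is_derive_eq.
    by rewrite /GRing.scale /= ?mul0r ?addr0; field.
  have : g 1 <= g z.
    apply: (@ger0_derive1_le_cc _ g 1 z) => //.
    - move=> x; rewrite in_itv /= => /andP[x1 _].
      by have [] := dg x (ltW x1).
    - move=> x; rewrite in_itv /= => /andP[x1 _].
      rewrite derive1E; have /@derive_val -> := dg x (ltW x1).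
      have -> : 1 + x^-1 ^+ 2 - 2 * x^-1 = (1 - x^-1) ^+ 2 by ring.
      exact: sqr_ge0.
    - apply: derivable_within_continuous => x; rewrite in_itv /= => /andP[x1 _].
      by have [] := dg x x1.
    - by rewrite in_itv /= lexx.
    - by rewrite in_itv /= lexx andbT.
  by rewrite /g ln1 invr1; lra.
have main (z : R) : 1 <= z -> ln z ^+ 2 <= z + z^-1 - 2.
  move=> z1; have z0 : 0 < z by apply: lt_le_trans z1.
  pose w := Num.sqrt z.
  have w1 : 1 <= w by rewrite /w -(@sqrtr1 R) ler_wsqrtr.
  have w0 : 0 < w by apply: lt_le_trans w1.
  have zw : z = w ^+ 2 by rewrite /w sqr_sqrtr // ltW.
  have -> : z + z^-1 - 2 = (w - w^-1) ^+ 2.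
    by rewrite zw; field; rewrite gt_eqF.
  have -> : ln z = 2 * ln w by rewrite zw lnXn // mulr_natl.
  rewrite ler_pXn2r // ?nnegrE; last first.
  - by rewrite subr_ge0 (le_trans _ w1) // invf_le1.
  - by rewrite mulr_ge0 // ln_ge0.
  exact: sinh_ge.
move=> y0; have [y1|y1] := leP 1 y; first exact: main.
have := main y^-1; rewrite lnV ?posrE // sqrrN invrK => h.
rewrite [y + _]addrC; apply: h.
by rewrite invf_ge1 // ltW.
Qed.

Lemma ln_le_subr1 (R : realType) (x : R) : 0 < x -> ln x <= x - 1.
Proof.
move=> x0; have : ln (1 + (x - 1)) <= x - 1 by apply: le_ln1Dx; lra.
by rewrite addrC subrK.
Qed.

Lemma sum_shift (R : realType) (V : finZmodType) (a : V) (F : V -> R) :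
  \sum_k F (k + a) = \sum_k F k.
Proof. by rewrite [RHS](reindex_inj (addIr a)). Qed.

Lemma card_Z (N : nat) : (1 < N)%N -> #|'Z_N| = N.
Proof. by move=> N1; rewrite card_ord Zp_cast. Qed.

Lemma sum_dlap (R : realType) (N : nat) (f : 'Z_N -> R) : \sum_k dlap f k = 0.
Proof.
rewrite /dlap -mulr_suml big_split /= big_split /= !sum_shift sumrN -mulr_sumr.
by rewrite [X in X / _](_ : _ = 0) ?mul0r //; ring.
Qed.

Lemma sum_dlss_field (R : realType) (N : nat) (r : 'Z_N -> R) :
  \sum_k dlss_field r k = 0.
Proof. by rewrite /dlss_field -mulr_sumr sum_dlap mulr0. Qed.

(** The gap in the comparison of the two squares with [v + 1/v - 2], [v = x/y],
    is the square [(x-y)^2 (1 - 1/(xy))^2 / 2].  The linear term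
    [- 2 (ln c + ln a - 2 ln b)] is kept because it sums to zero over a cycle. *)
Lemma sqrt_ratio_term (R : realType) (a b c x y : R) : 0 < a -> 0 < b -> 0 < c ->
  x = c / b -> y = b / a ->
  x * y + (x * y)^-1 - 2 * (x / y) - 2^-1 * (x ^+ 2 + y ^+ 2)
    - 2^-1 * (x ^- 2 + y ^- 2) + 2
  <= - (ln c + ln a - 2 * ln b) ^+ 2 - 2 * (ln c + ln a - 2 * ln b).
Proof.
move=> a0 b0 c0 xE yE.
have x0 : 0 < x by rewrite xE divr_gt0.
have y0 : 0 < y by rewrite yE divr_gt0.
have v0 : 0 < x / y by rewrite divr_gt0.
have lnv : ln (x / y) = ln c + ln a - 2 * ln b.
  by rewrite xE yE !ln_div ?posrE ?divr_gt0 //; ring.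
rewrite -lnv; set v := x / y in v0 lnv *.
have h1 := sqr_ln_le v0.
have h2 := ln_le_subr1 v0.
have h3 : x * y + (x * y)^-1 - 2^-1 * (x ^+ 2 + y ^+ 2)
    - 2^-1 * (x ^- 2 + y ^- 2) <= - (v + v^-1 - 2).
  rewrite -subr_ge0.
  have -> : - (v + v^-1 - 2) - (x * y + (x * y)^-1 - 2^-1 * (x ^+ 2 + y ^+ 2)
    - 2^-1 * (x ^- 2 + y ^- 2)) = 2^-1 * (x - y) ^+ 2 * (1 - (x * y)^-1) ^+ 2.
    by rewrite /v; field; rewrite !gt_eqF.
  by apply: mulr_ge0; [apply: mulr_ge0 => //|]; exact: sqr_ge0.
lra.
Qed.

Section SqrtRatios.
Variables (R : realType) (V : finZmodType) (e : V) (s : V -> R).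
Hypothesis s_gt0 : forall k, 0 < s k.
Let x k := s (k + e) / s k.

(** For [s] the square root of a positive function, the left-hand side is the
    sum of the second difference of [s_(k+1) s_(k-1) - s_k^2] divided by [s_k^2].
    The pointwise inequality is false: the bound needs the shifts of
    the index that turn the summand into the symmetric expression [T]. *)
Lemma sqrt_ratio_sum :
  \sum_k (s (k + e + e) * s k + s k * s (k - e - e)
           - 2 * (s (k + e) * s (k - e))
           - (s (k + e) ^+ 2 + s (k - e) ^+ 2 - 2 * s k ^+ 2)) / s k ^+ 2
  <= - \sum_k (ln (s (k + e)) + ln (s (k - e)) - 2 * ln (s k)) ^+ 2.
Proof.
pose y k := s k / s (k - e).
pose T k := x k * y k + (x k * y k)^-1 - 2 * (x k / y k)
   - 2^-1 * (x k ^+ 2 + y k ^+ 2) - 2^-1 * (x k ^- 2 + y k ^- 2) + 2.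
have s0 k : s k != 0 by rewrite gt_eqF.
have xE k : y (k + e) = x k by rewrite /x /y addrK.
have yE k : x (k - e) = y k by rewrite /x /y subrK.
have sh (F : V -> R) : \sum_k F (k - e) = \sum_k F k by exact: sum_shift.
have sp (F : V -> R) : \sum_k F (k + e) = \sum_k F k by exact: sum_shift.
pose G k := x k * y k.
pose Y k := y k ^+ 2.
pose Gi k := (G k)^-1.
pose Yi k := (Y k)^-1.
pose u k := ln (s (k + e)) + ln (s (k - e)) - 2 * ln (s k).
have PE k : (s (k + e + e) * s k + s k * s (k - e - e)
           - 2 * (s (k + e) * s (k - e))
           - (s (k + e) ^+ 2 + s (k - e) ^+ 2 - 2 * s k ^+ 2)) / s k ^+ 2
  = T k + (G (k + e) - G k) + (Gi (k - e) - Gi k)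
    - 2^-1 * (Y (k + e) - Y k) + 2^-1 * (Yi (k + e) - Yi k).
  rewrite /T /Gi /Yi /G /Y !xE !yE /x /y; field.
  by rewrite !s0.
under eq_bigr do rewrite PE.
have diff0 (F : V -> R) a : \sum_k (F (k + a) - F k) = 0.
  by rewrite sumrB sum_shift subrr.
have split5 (t a b c d : V -> R) :
    \sum_k (t k + a k + b k - 2^-1 * c k + 2^-1 * d k) =
    \sum_k t k + \sum_k a k + \sum_k b k - 2^-1 * \sum_k c k
      + 2^-1 * \sum_k d k.
  by rewrite big_split /= sumrB !big_split /= -!mulr_sumr.
rewrite (split5 T (fun k => G (k + e) - G k) (fun k => Gi (k - e) - Gi k)
  (fun k => Y (k + e) - Y k) (fun k => Yi (k + e) - Yi k)) !diff0.
rewrite !mulr0 oppr0 !addr0.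
apply: (@le_trans _ _ (\sum_k (- u k ^+ 2 - 2 * u k))).
  by apply: ler_sum => k _; apply: sqrt_ratio_term.
have u0 : \sum_k u k = 0.
  rewrite /u sumrB big_split /= (sh (fun k => ln (s k))) (sp (fun k => ln (s k))).
  by rewrite -mulr_sumr; ring.
by rewrite sumrB sumrN -mulr_sumr u0 mulr0 subr0.
Qed.
End SqrtRatios.

(** For a solution, [dlss_field r k / r k] is the time derivative of [ln (r k)], so
    that the right-hand side is the rate of decrease of [log_functional].  With
    [s] the square root of [r], this is [sqrt_ratio_sum] multiplied by
    [- 2 / mesh^3]. *)
Lemma entropy_production (R : realType) (N : nat) (r : 'Z_N -> R) :
  (1 < N)%N -> (forall k, 0 < r k) ->
  2^-1 * log_dissipation r <= mesh R N * \sum_k dlss_field r k / r k.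
Proof.
move=> N1 r0; rewrite /log_dissipation mulrCA.
have d0 : 0 < mesh R N by rewrite invr_gt0 ltr0n ltnW.
rewrite ler_pM2l //.
pose s k := Num.sqrt (r k).
have s0 k : 0 < s k by rewrite sqrtr_gt0.
have rE k : r k = s k ^+ 2 by rewrite sqr_sqrtr // ltW.
have gE k j : Num.sqrt (r k * r j) = s k * s j by rewrite sqrtrM // ltW.
have lnE k : ln (r k) = 2 * ln (s k) by rewrite rE lnXn // mulr_natl.
have := @sqrt_ratio_sum R _ (1 : 'Z_N) s s0.
set A := \sum_k _; set B := \sum_k _ => AB.
have -> : \sum_k dlss_field r k / r k = (- 2 / mesh R N ^+ 4) * A.
  rewrite mulr_sumr; apply: eq_bigr => k _.
  rewrite /dlss_field /dlap !gE addrK subrK !rE.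
  by field; rewrite !gt_eqF.
have -> : \sum_k `|dlap (fun j => ln (r j)) k| ^+ 2 = 4 / mesh R N ^+ 4 * B.
  rewrite mulr_sumr; apply: eq_bigr => k _.
  rewrite real_normK ?num_real // /dlap !lnE.
  by field; rewrite !gt_eqF.
have -> : 2^-1 * (4 / mesh R N ^+ 4 * B) = 2 / mesh R N ^+ 4 * B.
  by field; rewrite gt_eqF.
rewrite !mulNr -mulrN ler_pM2l ?divr_gt0 ?exprn_gt0 //.
by rewrite lerNr.
Qed.

(** Jensen's inequality, through the tangent [r - 1] of the logarithm at the mean
    value 1 of [r]. *)
Lemma log_functional_ge0 (R : realType) (N : nat) (r : 'Z_N -> R) :
  (1 < N)%N -> pos_density r -> 0 <= log_functional r.
Proof.
move=> N1 [r0 mass]; rewrite /log_functional oppr_ge0.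
have d0 : 0 < mesh R N by rewrite invr_gt0 ltr0n ltnW.
rewrite pmulr_rle0 //; apply: (@le_trans _ _ (\sum_k (r k - 1))).
  by apply: ler_sum => k _; exact: ln_le_subr1.
rewrite sumrB sumr_const card_Z // subr_le0.
by rewrite -(ler_pM2l d0) mass /mesh mulVf // pnatr_eq0; case: (N) N1.
Qed.

Lemma sum_pos_density (R : realType) (N : nat) (r : 'Z_N -> R) :
  (1 < N)%N -> mesh R N * \sum_k r k = 1 -> \sum_k r k = N%:R.
Proof.
move=> N1; rewrite /mesh => h.
have n0 : N%:R != 0 :> R by rewrite pnatr_eq0; case: (N) N1.
by rewrite -[LHS](mulVKf n0) h mulr1.
Qed.

Lemma pos_density_le (R : realType) (N : nat) (r : 'Z_N -> R) k :
  (1 < N)%N -> pos_density r -> r k <= N%:R.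
Proof.
move=> N1 [r0 /(sum_pos_density _)<-//]; rewrite (bigD1 k) //= lerDl.
by rewrite sumr_ge0 // => j _; exact: ltW.
Qed.

(** The logarithms of the other components add up to at most the total mass [N],
    so that a single component cannot be small without making [log_functional]
    large. *)
Lemma pos_density_ge (R : realType) (N : nat) (r : 'Z_N -> R) (L0 : R) k :
  (1 < N)%N -> pos_density r -> log_functional r <= L0 ->
  expR (- (N%:R * (L0 + 1))) <= r k.
Proof.
move=> N1 dr hL; have [r0 mass] := dr.
have Nr := sum_pos_density N1 mass.
have n0 : 0 < N%:R :> R by rewrite ltr0n ltnW.
have {}hL : - (N%:R * L0) <= \sum_k ln (r k).
  by rewrite lerNl -ler_pdivrMl // mulrN.
have h : \sum_(j | j != k) ln (r j) <= N%:R.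
  rewrite -Nr [leRHS](bigD1 k) //=.
  apply: (@le_trans _ _ (\sum_(j | j != k) r j)); last by rewrite lerDr ltW.
  by apply: ler_sum => j _; apply: ltW; exact: ln_sublinear.
rewrite -(@lnK _ (r k)) ?posrE // ler_expR.
move: hL; rewrite (bigD1 k) //=; lra.
Qed.

(** * The discrete Poincare inequality *)

Section CyclicFourier.
Variables (R : realType) (n : nat).
Let N := n.+2.
Let theta : R := 2 * pi * mesh R N.

(** Real and imaginary part of the additive character of the cyclic group: [cosZ]
    and [sinZ] obey the addition formulas for addition modulo [N]. *)
Definition cosZ (z : 'Z_N) : R := cos (z%:R * theta).
Definition sinZ (z : 'Z_N) : R := sin (z%:R * theta).

Let N_gt0 : 0 < N%:R :> R. Proof. by rewrite ltr0n. Qed.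
Let Ntheta : N%:R * theta = pi *+ 2.
Proof. by rewrite /theta /mesh mulrCA mulfV ?gt_eqF // mulr1 mulr_natl. Qed.

Lemma angle_mod (m : nat) :
  m%:R * theta = (m %% N)%:R * theta + (pi *+ 2) *+ (m %/ N).
Proof.
rewrite {1}(divn_eq m N) natrD mulrDl addrC; congr (_ + _).
by rewrite natrM -mulrA Ntheta mulr_natl.
Qed.

Lemma cosZ_nat (m : nat) : cosZ m%:R = cos (m%:R * theta).
Proof.
by rewrite (angle_mod m) (periodicn (@cosD2pi R)) /cosZ Zp_nat.
Qed.

Lemma sinZ_nat (m : nat) : sinZ m%:R = sin (m%:R * theta).
Proof.
by rewrite (angle_mod m) (periodicn (@sinD2pi R)) /sinZ Zp_nat.
Qed.

Lemma cosZD x y : cosZ (x + y) = cosZ x * cosZ y - sinZ x * sinZ y.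
Proof.
by rewrite -[x]natr_Zp -[y]natr_Zp -natrD !cosZ_nat !sinZ_nat natrD mulrDl cosD.
Qed.

Lemma sinZD x y : sinZ (x + y) = sinZ x * cosZ y + cosZ x * sinZ y.
Proof.
by rewrite -[x]natr_Zp -[y]natr_Zp -natrD !cosZ_nat !sinZ_nat natrD mulrDl sinD.
Qed.

Lemma cosZ0 : cosZ 0 = 1. Proof. by rewrite /cosZ mul0r cos0. Qed.
Lemma sinZ0 : sinZ 0 = 0. Proof. by rewrite /sinZ mul0r sin0. Qed.
Lemma cosZ2DsinZ2 x : cosZ x ^+ 2 + sinZ x ^+ 2 = 1.
Proof. exact: cos2Dsin2. Qed.

Lemma cosZ_sub x y : cosZ (x - y) = cosZ x * cosZ y + sinZ x * sinZ y.
Proof.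
have := cosZD (x - y) y; have := sinZD (x - y) y; rewrite subrK => -> ->.
by have := cosZ2DsinZ2 y; set c := cosZ y; set s := sinZ y => h;
  rewrite -[LHS]mulr1 -h; ring.
Qed.

Lemma sinZ_sub x y : sinZ (x - y) = sinZ x * cosZ y - cosZ x * sinZ y.
Proof.
have := cosZD (x - y) y; have := sinZD (x - y) y; rewrite subrK => -> ->.
by have := cosZ2DsinZ2 y; set c := cosZ y; set s := sinZ y => h;
  rewrite -[LHS]mulr1 -h; ring.
Qed.

Lemma cos_theta_lt1 : cos theta < 1.
Proof.
have t0 : 0 < theta by rewrite !mulr_gt0 ?pi_gt0 // invr_gt0.
have tpi : theta <= pi.
  rewrite -(ler_pM2l N_gt0) Ntheta -[pi *+ 2]mulr_natl ler_wpM2r ?pi_ge0 //.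
  by rewrite ler_nat.
by rewrite -cos0 ltr_cos // in_itv /= ?lexx ?pi_ge0 ?(ltW t0).
Qed.

(** All nonzero frequencies are at distance at least one from 0 on the cycle;
    those beyond half of the cycle are reflected into [[0, pi]], where the
    cosine decreases. *)
Lemma cosZ_le z : z != 0 -> cosZ z <= cos theta.
Proof.
move=> z0.
have t0 : 0 < theta by rewrite !mulr_gt0 ?pi_gt0 // invr_gt0.
have main (m : nat) : (0 < m)%N -> m%:R * theta <= pi ->
    cos (m%:R * theta) <= cos theta.
  move=> m0 mpi.
  have h : theta <= m%:R * theta by rewrite ler_peMl ?(ltW t0) // ler1n.
  rewrite leNgt ltr_cos ?in_itv /= -?leNgt //.
  - by rewrite mpi mulr_ge0 // ltW.
  - by rewrite (ltW t0) (le_trans h).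
have zN : (z < N)%N := ltn_ord z.
have z1 : (0 < z)%N by rewrite lt0n.
have [h|h] := leP (z%:R * theta) pi; first exact: main.
have -> : cosZ z = cos ((N - z)%:R * theta).
  rewrite natrB ?(ltnW zN) // mulrBl Ntheta -cosN opprB.
  by rewrite -[in RHS](cosD2pi) subrK.
apply: main; first by rewrite subn_gt0.
rewrite natrB ?(ltnW zN) // mulrBl Ntheta mulr2n.
by rewrite lerBlDr lerD2l ltW.
Qed.

(** Orthogonality of characters: shifting [j] by one rotates the vector formed by
    the cosine and the sine sum by the angle of [z], so that it vanishes unless
    the rotation is trivial. *)
Lemma sum_cosZ (z : 'Z_N) : \sum_(j : 'Z_N) cosZ (j * z) = (z == 0)%:R * N%:R.
Proof.
case: eqP => [->|/eqP z0].
  under eq_bigr do rewrite mulr0 cosZ0.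
  by rewrite sumr_const card_ord mul1r.
rewrite mul0r.
pose S := \sum_(j : 'Z_N) cosZ (j * z).
pose T := \sum_(j : 'Z_N) sinZ (j * z).
have ES : S = S * cosZ z - T * sinZ z.
  rewrite {1}/S -(sum_shift 1) !mulr_suml -sumrB; apply: eq_bigr => j _.
  by rewrite mulrDl mul1r cosZD.
have ET : T = T * cosZ z + S * sinZ z.
  rewrite {1}/T -(sum_shift 1) !mulr_suml -big_split; apply: eq_bigr => j _.
  by rewrite mulrDl mul1r sinZD.
have c1 : cosZ z < 1 by apply: le_lt_trans (cosZ_le z0) cos_theta_lt1.
have := cosZ2DsinZ2 z; rewrite -/S.
set c := cosZ z in ES ET c1 *; set s := sinZ z in ES ET * => cs.
have h : S * (2 - 2 * c) = 0.
  have -> : 2 - 2 * c = (1 - c) ^+ 2 + s ^+ 2 by lra.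
  have E1 : S * (1 - c) = - T * s by lra.
  have E2 : T * (1 - c) = S * s by lra.
  have -> : S * ((1 - c) ^+ 2 + s ^+ 2) = S * (1 - c) * (1 - c) + S * s * s.
    by ring.
  by rewrite E1 -E2; ring.
by move/eqP: h; rewrite mulf_eq0 => /orP[/eqP //|/eqP]; lra.
Qed.

Section Transform.
Variable f : 'Z_N -> R.
(** Real part and, up to the sign, imaginary part of the Fourier transform. *)
Definition dftc (j : 'Z_N) := \sum_k f k * cosZ (j * k).
Definition dfts (j : 'Z_N) := \sum_k f k * sinZ (j * k).

Lemma dft_parseval :
  \sum_j (dftc j ^+ 2 + dfts j ^+ 2) = N%:R * \sum_k f k ^+ 2.
Proof.
have E j : dftc j ^+ 2 + dfts j ^+ 2 =
    \sum_k \sum_l f k * f l * cosZ (j * (k - l)).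
  rewrite !expr2 /dftc /dfts !big_distrlr -big_split; apply: eq_bigr => k _ /=.
  rewrite -big_split; apply: eq_bigr => l _ /=; rewrite mulrBr cosZ_sub mulrDr.
  by congr (_ + _); rewrite mulrACA.
under eq_bigr do rewrite E.
rewrite exchange_big mulr_sumr; apply: eq_bigr => k _ /=.
rewrite exchange_big (bigD1 k) //= [X in _ + X]big1 => [|l lk].
  by rewrite -mulr_sumr sum_cosZ subrr eqxx mul1r addr0 mulrC expr2.
by rewrite -mulr_sumr sum_cosZ subr_eq0 eq_sym (negPf lk) mul0r mulr0.
Qed.

End Transform.

(** In the complex picture, shifting the argument by one multiplies mode [j] by a
    complex number [w] of modulus 1 and real part [cosZ j], and
    [|w - 1|^2 = 2 - 2 cosZ j]. *)
Lemma dft_diff (f : 'Z_N -> R) (j : 'Z_N) :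
  dftc (fun k => f (k + 1) - f k) j ^+ 2 + dfts (fun k => f (k + 1) - f k) j ^+ 2
  = (2 - 2 * cosZ j) * (dftc f j ^+ 2 + dfts f j ^+ 2).
Proof.
have Ec : dftc (fun k => f (k + 1) - f k) j =
    (cosZ j - 1) * dftc f j + sinZ j * dfts f j.
  rewrite /dftc; under eq_bigr do rewrite mulrBl.
  rewrite sumrB [X in X - _](_ : _ = \sum_k f k * cosZ (j * (k - 1))); last first.
    by rewrite -[RHS](sum_shift 1); apply: eq_bigr => k _; rewrite addrK.
  rewrite mulrBl mul1r addrAC; congr (_ - _).
  rewrite /dfts !mulr_sumr -big_split; apply: eq_bigr => k _ /=.
  by rewrite mulrBr mulr1 cosZ_sub; ring.
have Es : dfts (fun k => f (k + 1) - f k) j =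
    (cosZ j - 1) * dfts f j - sinZ j * dftc f j.
  rewrite /dfts; under eq_bigr do rewrite mulrBl.
  rewrite sumrB [X in X - _](_ : _ = \sum_k f k * sinZ (j * (k - 1))); last first.
    by rewrite -[RHS](sum_shift 1); apply: eq_bigr => k _; rewrite addrK.
  rewrite mulrBl mul1r addrAC; congr (_ - _).
  rewrite /dftc !mulr_sumr -sumrB; apply: eq_bigr => k _ /=.
  by rewrite mulrBr mulr1 sinZ_sub; ring.
rewrite Ec Es; have := cosZ2DsinZ2 j; set c := cosZ j; set s := sinZ j => cs.
have -> : 2 - 2 * c = (c - 1) ^+ 2 + s ^+ 2 by lra.
ring.
Qed.

(** In Fourier space, mode 0 vanishes by the mean condition and every other mode
    gains at least the factor [2 - 2 cos theta]. *)
Lemma fourier_poincare (f : 'Z_N -> R) : \sum_k f k = 0 ->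
  (2 - 2 * cos theta) * \sum_k f k ^+ 2 <= \sum_k (f (k + 1) - f k) ^+ 2.
Proof.
move=> f0; rewrite -(ler_pM2l N_gt0) mulrCA -!dft_parseval mulr_sumr.
apply: ler_sum => j _; rewrite dft_diff.
have [->|j0] := eqVneq j 0.
  have -> : dftc f 0 = 0.
    by rewrite /dftc (eq_bigr f) // => k _; rewrite mul0r cosZ0 mulr1.
  have -> : dfts f 0 = 0.
    by rewrite /dfts big1 // => k _; rewrite mul0r sinZ0 mulr0.
  by rewrite expr0n /= addr0 !mulr0.
rewrite ler_wpM2r ?addr_ge0 ?sqr_ge0 // lerD2l lerN2 ler_pM2l //.
exact: cosZ_le.
Qed.

End CyclicFourier.

Lemma discrete_poincare (R : realType) (N : nat) (f : 'Z_N -> R) :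
  (1 < N)%N -> \sum_k f k = 0 ->
  2 * (1 - cos (2 * pi * mesh R N)) * \sum_k f k ^+ 2
    <= \sum_k (f (k + 1) - f k) ^+ 2.
Proof.
case: N f => [|[|n]] // f _ f0; rewrite mulrBr mulr1; exact: fourier_poincare.
Qed.

(** The two arcs joining [k] and [l] share the total variation of [g]. *)
Lemma osc_le_half_variation (R : realType) (N : nat) (g : 'Z_N -> R) k l :
  (1 < N)%N -> 2 * `|g k - g l| <= \sum_j `|g (j + 1) - g j|.
Proof.
case: N g k l => [|[|n]] // g k l _.
pose h (i : nat) := g (k + i%:R).
pose m : nat := nat_of_ord (l - k)%R.
have hm : h m = g l by rewrite /h /m natr_Zp addrC subrK.
have h0 : h 0%N = g k by rewrite /h addr0.
have hN : h n.+2 = g k by rewrite /h pchar_Zp // addr0.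
have tv (a b : nat) : (a <= b)%N ->
    `|h b - h a| <= \sum_(a <= i < b) `|h i.+1 - h i|.
  by move=> ab; rewrite -telescope_sumr // ler_norm_sum.
have mN : (m <= n.+2)%N by rewrite ltnW // ltn_ord.
have := lerD (tv _ _ (leq0n m)) (tv _ _ mN).
rewrite -big_cat_nat //= hm h0 hN distrC big_mkord => H.
rewrite mulrDl !mul1r (le_trans H) //.
rewrite -[leRHS](sum_shift k) le_eqVlt; apply/orP; left; apply/eqP.
apply: eq_bigr => i _; rewrite /h -natr1 natr_Zp.
by rewrite [i + k]addrC addrA.
Qed.

Lemma sqr_sum_le (R : realType) (T : finType) (a : T -> R) :
  (\sum_k a k) ^+ 2 <= #|T|%:R * \sum_k a k ^+ 2.
Proof.
have [T0|T0] := posnP #|T|.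
  by rewrite !big_pred0 ?expr0n ?mulr0 // => i; have := fintype0 i T0.
have c0 : 0 < #|T|%:R :> R by rewrite ltr0n.
set S := \sum_k a k; pose m := S / #|T|%:R.
have : 0 <= \sum_k (a k - m) ^+ 2 by apply: sumr_ge0 => k _; exact: sqr_ge0.
have -> : \sum_k (a k - m) ^+ 2
    = \sum_k a k ^+ 2 - 2 * m * S + #|T|%:R * m ^+ 2.
  rewrite /S mulr_sumr -sumrB [#|T|%:R * _]mulr_natl -sumr_const -big_split.
  by apply: eq_bigr => k _ /=; ring.
rewrite -(pmulr_rge0 _ c0) => h; rewrite -subr_ge0.
rewrite (le_trans h) // le_eqVlt; apply/orP; left; apply/eqP.
by rewrite /m; field; rewrite gt_eqF.
Qed.

(** The factor [1/4] is the square of the [1/2] of [osc_le_half_variation].  The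
    Poincare inequality is applied to the first difference of [ln r], which has
    zero average and whose differences are the second differences of [ln r]. *)
Lemma log_osc2_le (R : realType) (N : nat) (r : 'Z_N -> R) : (1 < N)%N ->
  log_osc2 r <= C_PI R N / 4 * log_dissipation r.
Proof.
move=> N1; apply: ge_sup => [|x [k [l ->]]].
  by exists (`|ln (r 0) - ln (r 0)| ^+ 2), 0, 0.
pose g j := ln (r j).
pose w := 2 * (1 - cos (2 * pi * mesh R N)).
have w0 : 0 < w.
  rewrite /w mulr_gt0 // subr_gt0; move: N1; clear; case: N => [|[|n]] // _.
  exact: cos_theta_lt1.
have n0 : N%:R != 0 :> R by rewrite pnatr_eq0 -lt0n ltnW.
have H1 := osc_le_half_variation g k l N1.
have H2 := sqr_sum_le (fun j => `|g (j + 1) - g j|).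
have D0 : \sum_j (g (j + 1) - g j) = 0.
  by rewrite sumrB sum_shift subrr.
have H3 := discrete_poincare N1 D0; rewrite -/w in H3.
have E : \sum_j (g (j + 1 + 1) - g (j + 1) - (g (j + 1) - g j)) ^+ 2
   = mesh R N ^+ 4 * \sum_j `|dlap g j| ^+ 2.
  rewrite mulr_sumr -[RHS](sum_shift 1); apply: eq_bigr => j _.
  rewrite real_normK ?num_real // /dlap addrK /mesh; field.
  by rewrite n0.
rewrite {}E in H3.
rewrite card_Z // in H2.
have E2 : \sum_k `|g (k + 1) - g k| ^+ 2 = \sum_k (g (k + 1) - g k) ^+ 2.
  by apply: eq_bigr => j _; rewrite real_normK ?num_real.
rewrite {}E2 in H2.
have H4 : (2 * `|g k - g l|) ^+ 2 <= N%:R * \sum_k (g (k + 1) - g k) ^+ 2.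
  apply: le_trans H2; rewrite ler_pXn2r // ?nnegrE ?mulr_ge0 //.
  by apply: sumr_ge0.
rewrite /log_dissipation /C_PI -/w -/g.
set X := \sum_k `|_| ^+ 2 in H3 *; set Y := \sum_k _ ^+ 2 in H3 H4.
rewrite -(ler_pM2l w0).
have -> : w * (mesh R N ^+ 2 / w / 4 * (mesh R N * X)) =
   N%:R / 4 * (mesh R N ^+ 4 * X).
  by rewrite /mesh; field; rewrite n0 gt_eqF.
apply: (@le_trans _ _ (N%:R / 4 * (w * Y))); last first.
  by rewrite ler_wpM2l // divr_ge0.
have -> : N%:R / 4 * (w * Y) = w * (4^-1 * (N%:R * Y)) by ring.
rewrite ler_pM2l // -/g.
move: H4; rewrite exprMn; lra.
Qed.

(** * Comparison, primitives and the Picard-Lindelof theorem *)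

Lemma le_of_derive (R : realType) (f g df dg : R -> R) (a b : R) : a <= b ->
  {within `[a, b], continuous f} -> {within `[a, b], continuous g} ->
  (forall t : R, a < t < b -> is_derive t (1 : R) f (df t)) ->
  (forall t : R, a < t < b -> is_derive t (1 : R) g (dg t)) ->
  (forall t, a < t < b -> df t <= dg t) ->
  f b - f a <= g b - g a.
Proof.
move=> ab cf cg hf hg le_d.
(* the derivatives are known in the open interval only, while the mean value
   point may be an end point when a = b; the value 0 there is harmless *)
have [||c _ E] := @MVT_segment R (fun t => g t - f t)
  (fun t => if a < t < b then dg t - df t else 0) a b ab.
- move=> t; rewrite in_itv /= => tab; rewrite tab.
  have := hf _ tab; have := hg _ tab => ? ?; exact: is_deriveB.
- by move=> t; apply: continuousB; [exact: cg|exact: cf].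
have : 0 <= (if a < c < b then dg c - df c else 0) * (b - a).
  apply: mulr_ge0; last by rewrite subr_ge0.
  by case: ifP => // /le_d; rewrite subr_ge0.
by rewrite -E; lra.
Qed.

(** Continuity of a function on the half-line [[0, +oo[] is expressed below as
    continuity of its composite with [clamp0], which avoids subspace topologies. *)
Definition clamp0 (R : realType) (t : R) := Num.max t 0.

Lemma continuous_clamp0 (R : realType) : continuous (@clamp0 R).
Proof.
move=> t; apply: (@continuous_max _ _ (fun x => x) (fun=> 0) t); first exact: cvg_id.
exact: cst_continuous.
Qed.

(** Integrating from -1 rather than from 0 makes 0 an interior point, so that the
    derivative is two-sided there too. *)
Lemma primitive_exists (R : realType) (f : R -> R) :
  continuous (fun t => f (clamp0 t)) ->
  exists F : R -> R, F 0 = 0 /\ forall t : R, 0 <= t -> is_derive t (1 : R) F (f t).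
Proof.
move=> cf; pose g t := f (clamp0 t).
pose G x := (\int[lebesgue_measure]_(t in `[(-1 : R), x]) g t)%R.
exists (fun x => G x - G 0); split; first by rewrite subrr.
move=> t t0.
have intg : lebesgue_measure.-integrable `[(-1 : R), t + 1] (EFin \o g).
  apply: continuous_compact_integrable; first exact: segment_compact.
  exact: continuous_subspaceT.
have h1 : t < t + 1 by lra.
have h2 : -1 < t by lra.
have [dG G't] := continuous_FTC1_closed h1 intg h2 (cf t).
have gt : g t = f t by rewrite /g /clamp0 max_l.
rewrite -gt -G't derive1E.
have HG : is_derive t 1 G ('D_1 G t) by exact: derivableP.
apply: is_derive_eq; exact: subr0.
Qed.

Section PicardLindelof.
Variables (R : realType) (I : finType) (F : (I -> R) -> I -> R) (K : R).
Hypothesis K_gt0 : 0 < K.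
Hypothesis lipF : forall (x y : I -> R) (e : R), (forall j, `|x j - y j| <= e) ->
  forall k, `|F x k - F y k| <= K * e.

Lemma is_derive_weight (a t : R) :
  is_derive t (1 : R) (fun s => a * expR (2 * K * s)) (a * (2 * K) * expR (2 * K * t)).
Proof.
have h : is_derive t (1 : R) (fun s : R => 2 * K * s) (2 * K).
  by apply: is_derive_eq; rewrite /GRing.scale /= mulr1.
have h2 := @is_derive1_comp R expR (fun s => 2 * K * s) t _ _ (is_derive_expR _) h.
have h3 : is_derive t (1 : R) (fun s => a * expR (2 * K * s)) (a * (expR (2 * K * t) * (2 * K))).
  exact: is_deriveZ.
by apply: is_derive_eq; ring.
Qed.

(** One Picard step halves distances measured with the weight [exp (2 K s)], whose
    growth rate is twice the Lipschitz constant.  As [u] and [v] need not come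
    from the iteration, the estimate also yields uniqueness: two solutions may be
    compared with [u = x] and [v = y]. *)
Lemma picard_contraction (x y u v : R -> I -> R) (b C : R) : 0 <= C ->
  (forall s : R, 0 <= s <= b -> forall k, `|x s k - y s k| <= C * expR (2 * K * s)) ->
  (forall k, {within `[0, b], continuous (fun s => u s k)}) ->
  (forall k, {within `[0, b], continuous (fun s => v s k)}) ->
  (forall (s : R) k, 0 < s < b -> is_derive s (1 : R) (fun s => u s k) (F (x s) k)) ->
  (forall (s : R) k, 0 < s < b -> is_derive s (1 : R) (fun s => v s k) (F (y s) k)) ->
  u 0 = v 0 ->
  forall s : R, 0 <= s <= b -> forall k, `|u s k - v s k| <= C / 2 * expR (2 * K * s).
Proof.
move=> C0 xy cu cv du dv uv0 s /andP[s0 sb] k.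
pose w r := C / 2 * expR (2 * K * r).
have sub : `[0, s] `<=` `[0, b].
  by move=> r /=; rewrite !in_itv /= => /andP[-> /le_trans]; apply.
have inb (r : R) : 0 < r < s -> 0 < r < b.
  by case/andP=> -> rs; exact: lt_le_trans rs sb.
have cw : {within `[0, s], continuous w}.
  apply: derivable_within_continuous => r _.
  by have [] := is_derive_weight (C / 2) r.
have dw (r : R) : is_derive r (1 : R) w (C * K * expR (2 * K * r)).
  by apply: (is_derive_eq (is_derive_weight (C / 2) r)); field.
have bd (r : R) : 0 < r < s -> `|F (x r) k - F (y r) k| <= C * K * expR (2 * K * r).
  move=> /inb/andP[r0 rb].
  rewrite [leRHS](_ : _ = K * (C * expR (2 * K * r))); last by ring.
  by apply: lipF => j; apply: xy; rewrite !ltW.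
have bnd (z : R -> R) (dz : R -> R) : {within `[0, s], continuous z} ->
    (forall r : R, 0 < r < s -> is_derive r (1 : R) z (dz r)) ->
    (forall r : R, 0 < r < s -> dz r <= C * K * expR (2 * K * r)) ->
    z s - z 0 <= w s.
  move=> cz hz lz; apply: (@le_trans _ _ (w s - w 0)).
    exact: (@le_of_derive R z w dz (fun r => C * K * expR (2 * K * r)) 0 s).
  by rewrite gerBl /w mulr_ge0 ?divr_ge0 ?expR_ge0.
have cuv : {within `[0, s], continuous (fun r => u r k - v r k)}.
  move=> r; apply: continuousB; exact: (continuous_subspaceW sub (_ : {within _, continuous _})).
have cvu : {within `[0, s], continuous (fun r => v r k - u r k)}.
  move=> r; apply: continuousB; exact: (continuous_subspaceW sub (_ : {within _, continuous _})).
have B1 : u s k - v s k - (u 0 k - v 0 k) <= w s.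
  apply: (bnd _ (fun r => F (x r) k - F (y r) k) cuv) => r rs.
    by apply: is_deriveB; [exact/du/inb|exact/dv/inb].
  by rewrite (le_trans (ler_norm _)) // bd.
have B2 : v s k - u s k - (v 0 k - u 0 k) <= w s.
  apply: (bnd _ (fun r => F (y r) k - F (x r) k) cvu) => r rs.
    by apply: is_deriveB; [exact/dv/inb|exact/du/inb].
  by rewrite (le_trans (ler_norm _)) // distrC bd.
rewrite uv0 subrr subr0 in B1; rewrite uv0 subrr subr0 in B2.
by rewrite ler_norml -/(w s) lerNl opprB B1 B2.
Qed.

Lemma exists_half_pow_le (C e : R) : 0 < e -> exists n : nat, C / 2 ^+ n <= e.
Proof.
move=> e0; exists (Num.bound `|C / e|); set n := Num.bound _.
rewrite ler_pdivrMr ?exprn_gt0 // mulrC -ler_pdivrMr //.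
have h1 : C / e <= n%:R by apply: (le_trans (ler_norm _)); exact/ltW/archi_boundP.
apply: (le_trans h1); rewrite -natrX ler_nat ltnW //; exact: ltn_expl.
Qed.

(** The intervals of radius [2 D / 2 ^ n] around [u n] are nested. *)
Lemma geometric_cauchy_limit (u : nat -> R) (D : R) :
  (forall n, `|u n.+1 - u n| <= D / 2 ^+ n) ->
  exists l : R, forall n, `|l - u n| <= 2 * D / 2 ^+ n.
Proof.
move=> hu; pose lo n := u n - 2 * D / 2 ^+ n; pose up n := u n + 2 * D / 2 ^+ n.
have dS n : 2 * D / 2 ^+ n.+1 = D / 2 ^+ n.
  by rewrite exprS; field; rewrite expf_neq0.
have dd n : 2 * D / 2 ^+ n = D / 2 ^+ n + D / 2 ^+ n by rewrite -mulrA mulr_natl.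
have lo_nd : {homo lo : n m / (n <= m)%N >-> n <= m}.
  apply: homo_leq => [//|? ? ?|n]; first exact: le_trans.
  by rewrite /lo dS dd; have := hu n; rewrite ler_norml => /andP[]; lra.
have up_ni : {homo up : n m / (n <= m)%N >-> m <= n}.
  apply: homo_leq => [//|? ? ? h1 h2|n]; first exact: le_trans h2 h1.
  by rewrite /up dS dd; have := hu n; rewrite ler_norml => /andP[]; lra.
have lo_up n m : lo n <= up m.
  apply: (le_trans (lo_nd _ _ (leq_maxl n m))).
  apply: (le_trans _ (up_ni _ _ (leq_maxr n m))).
  rewrite /lo /up lerD2l; set p := maxn n m.
  have D0 : 0 <= D / 2 ^+ p by apply: le_trans (hu p).
  by rewrite dd; lra.
exists (sup (range lo)) => n.
have h1 : lo n <= sup (range lo).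
  apply: sup_upper_bound; last by exists n.
  split; first by exists (lo 0%N), 0%N.
  by exists (up 0%N) => _ [m _ <-]; exact: lo_up.
have h2 : sup (range lo) <= up n.
  apply: ge_sup; first by exists (lo 0%N), 0%N.
  by move=> _ [m _ <-]; exact: lo_up.
by rewrite ler_norml; move: h1 h2; rewrite /lo /up; lra.
Qed.

Definition continuous_from0 (x : R -> I -> R) :=
  forall k, continuous (fun t => x (clamp0 t) k).

Lemma lipschitz_continuous_from0 (x : R -> I -> R) : continuous_from0 x ->
  continuous_from0 (fun t => F (x t)).
Proof.
move=> cx k t; apply/cvgrPdist_le => e e0.
have near1 j : \forall s \near t, `|x (clamp0 t) j - x (clamp0 s) j| <= e / K.
  by have /cvgrPdist_le := cx j t; apply; rewrite divr_gt0.
near=> s.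
have hs : forall j, `|x (clamp0 t) j - x (clamp0 s) j| <= e / K.
  by near: s; exact: filter_forall near1.
by apply: le_trans (lipF hs k) _; rewrite mulrC divfK // gt_eqF.
Unshelve. all: by end_near. Qed.

Variable x0 : I -> R.

Lemma picard_step (x : R -> I -> R) : continuous_from0 x ->
  exists y : R -> I -> R, [/\ continuous_from0 y, y 0 = x0 &
    forall (t : R) k, 0 <= t -> is_derive t (1 : R) (fun s => y s k) (F (x t) k)].
Proof.
move=> cx.
have [Y hY] := choice (fun k => @primitive_exists R (fun t => F (x t) k) (@lipschitz_continuous_from0 x cx k)).
exists (fun t k => x0 k + Y k t).
have dY (t : R) k : 0 <= t -> is_derive t (1 : R) (fun s => x0 k + Y k s) (F (x t) k).
  move=> t0; have [_ /(_ t t0) h] := hY k.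
  by apply: is_derive_eq; rewrite add0r mul1r.
split => //; last by apply/funext => k; rewrite (hY k).1 addr0.
move=> k t.
apply: (@continuous_comp _ _ _ (@clamp0 R) (fun s => x0 k + Y k s)).
  exact: continuous_clamp0.
apply: differentiable_continuous; apply/derivable1_diffP.
have c0 : 0 <= clamp0 t by rewrite /clamp0 le_max lexx orbT.
by have [] := dY (clamp0 t) k c0.
Qed.

(** The iterates converge locally uniformly to a continuous [x]; one further step
    from [x] gives a differentiable [y], and [y] and [x] agree because both are
    limits of the iterates. *)
Theorem picard_lindelof : exists x : R -> I -> R, x 0 = x0 /\
  forall (t : R) k, 0 <= t -> is_derive t (1 : R) (fun s => x s k) (F (x t) k).
Proof.
pose X := {x : R -> I -> R | continuous_from0 x}.
have step (x : X) : {y : X | sval y 0 = x0 /\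
   forall (t : R) k, 0 <= t -> is_derive t (1 : R) (fun s => sval y s k) (F (sval x t) k)}.
  apply: cid; have [y [cy y0 dy]] := picard_step (svalP x).
  by exists (exist _ y cy).
have cst : continuous_from0 (fun=> x0) by move=> k t; exact: cvg_cst.
pose U n : X := iter n (fun x => sval (step x)) (exist _ _ cst).
pose u n := sval (U n).
have u0 n : u n 0 = x0.
  by case: n => [//|n]; rewrite /u /=; case: (svalP (step (U n))).
have du n (t : R) k : 0 <= t -> is_derive t (1 : R) (fun s => u n.+1 s k) (F (u n t) k).
  by rewrite /u /=; case: (svalP (step (U n))) => _; apply.
have cu (n : nat) (b : R) k : {within `[0, b], continuous (fun s => u n s k)}.
  case: n => [|n]; first by move=> s; exact: cvg_cst.
  apply: derivable_within_continuous => s; rewrite in_itv /= => /andP[s0 _].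
  by have [] := du n s k s0.
pose M := \sum_k `|F x0 k|; pose C := M / (2 * K).
have M0 : 0 <= M by apply: sumr_ge0.
have C0 : 0 <= C by rewrite divr_ge0 // mulr_ge0 // ltW.
have K2 : 0 < 2 * K by rewrite mulr_gt0.
(* the first increment grows at speed at most M, and C * exp (2 K s) at speed
   M * exp (2 K s); the later ones are halved by the contraction *)
have bound n (b : R) : forall s : R, 0 <= s <= b -> forall k,
    `|u n.+1 s k - u n s k| <= C / 2 ^+ n * expR (2 * K * s).
  elim: n => [|n IHn].
    move=> s /andP[s0 _] k; rewrite expr0 divr1.
    pose w r := C * expR (2 * K * r).
    have dw (r : R) : is_derive r (1 : R) w (M * expR (2 * K * r)).
      apply: (is_derive_eq (is_derive_weight C r)).
      by rewrite /C divfK // gt_eqF.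
    have cw (a : R) : {within `[0, a], continuous w}.
      by apply: derivable_within_continuous => r _; have [] := dw r.
    have FM (r : R) : 0 < r -> `|F x0 k| <= M * expR (2 * K * r).
      move=> r0; apply: (@le_trans _ _ M).
        by rewrite /M (bigD1 k) //= lerDl sumr_ge0.
      rewrite ler_peMr // (le_trans _ (expR_ge1Dx _)) // lerDl.
      by rewrite mulr_ge0 // ltW.
    have du' (r : R) : 0 < r < s -> is_derive r (1 : R) (fun q => u 1%N q k) (F x0 k).
      by case/andP=> r0 _; exact: (du 0%N r k (ltW r0)).
    have duN (r : R) : 0 < r < s -> is_derive r (1 : R) (fun q => - u 1%N q k) (- F x0 k).
      by move=> /du' h; exact: is_deriveN.
    have cN : {within `[0, s], continuous (fun q => - u 1%N q k)}.
      by move=> r; apply: continuousN; exact: cu.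
    have w0 : 0 <= w 0 by rewrite mulr_ge0 ?expR_ge0.
    have B1 := le_of_derive s0 (cu 1%N s k) (cw s) du' (fun r _ => dw r).
    have B2 := le_of_derive s0 cN (cw s) duN (fun r _ => dw r).
    rewrite u0 in B1 B2; rewrite -[u 0%N s k]/(x0 k) -/(w s) ler_norml.
    have {}B1 : u 1%N s k - x0 k <= w s - w 0.
      apply: B1 => r /andP[r0 _]; apply: le_trans (ler_norm _) _; exact: FM.
    have {}B2 : - u 1%N s k - - x0 k <= w s - w 0.
      apply: B2 => r /andP[r0 _]; apply: le_trans (ler_norm _) _.
      by rewrite normrN; exact: FM.
    lra.
  have -> : C / 2 ^+ n.+1 = C / 2 ^+ n / 2.
    by rewrite exprS; field; rewrite expf_neq0.
  apply: (@picard_contraction (u n.+1) (u n) (u n.+2) (u n.+1) b) => //.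
  - by rewrite divr_ge0 // exprn_ge0.
  - by move=> s k /andP[s0 _]; apply: du; exact: ltW.
  - by move=> s k /andP[s0 _]; apply: du; exact: ltW.
  - by rewrite !u0.
have lim (t : R) : exists l : I -> R, 0 <= t ->
    forall k n, `|l k - u n t k| <= 2 * C * expR (2 * K * t) / 2 ^+ n.
  have [t0|] := boolP (0 <= t); last by exists x0.
  have h k : exists l : R, forall n, `|l - u n t k| <= 2 * (C * expR (2 * K * t)) / 2 ^+ n.
    apply: geometric_cauchy_limit => n.
    rewrite mulrAC; apply: (@bound n t); by rewrite t0 lexx.
  have [l hl] := choice h.
  by exists l => _ k n; rewrite -[2 * C * _]mulrA.
have [x hx] := choice lim.
have cx : continuous_from0 x.
  move=> k t; apply/cvgrPdist_le => e e0.
  pose D := 2 * C * expR (2 * K * (clamp0 t + 1)).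
  have e3 : 0 < e / 3 by rewrite divr_gt0.
  have [n hn] := exists_half_pow_le D e3.
  have unif (s : R) : 0 <= s -> s <= clamp0 t + 1 -> `|x s k - u n s k| <= e / 3.
    move=> s0 st; apply: le_trans (hx s s0 k n) _; apply: le_trans hn.
    rewrite ler_pM2r ?invr_gt0 ?exprn_gt0 // /D; apply: ler_wpM2l.
      by rewrite mulr_ge0.
    by rewrite ler_expR ler_pM2l.
  have near1 : \forall s \near t, `|u n (clamp0 t) k - u n (clamp0 s) k| <= e / 3.
    have /cvgrPdist_le := svalP (U n) k t; apply; by rewrite divr_gt0.
  have near2 : \forall s \near t, `|clamp0 t - clamp0 s| <= 1.
    by have /cvgrPdist_le := @continuous_clamp0 R t; apply.
  have c0 (s : R) : 0 <= clamp0 s :> R by rewrite /clamp0 le_max lexx orbT.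
  apply: filterS2 near1 near2 => s h1; rewrite ler_norml => h2.
  have h3 : `|x (clamp0 t) k - u n (clamp0 t) k| <= e / 3.
    by apply: unif => //; rewrite lerDl.
  have h4 : `|x (clamp0 s) k - u n (clamp0 s) k| <= e / 3.
    apply: unif => //; move: h2 => /andP[]; lra.
  move: h1 h3 h4; rewrite !ler_norml => /andP[? ?] /andP[? ?] /andP[? ?]; lra.
have [y [cy y0 dy]] := picard_step cx.
have yx (t : R) : 0 <= t -> y t = x t.
  move=> t0; apply/funext => k; apply/eqP; rewrite -subr_eq0 -normr_le0.
  rewrite leNgt; apply/negP => d0.
  pose D := 2 * C * expR (2 * K * t).
  have d3 : 0 < `|y t k - x t k| / 3 by rewrite divr_gt0.
  have [n hn] := exists_half_pow_le D d3.
  have h1 : `|y t k - u n.+1 t k| <= 2 * C / 2 ^+ n / 2 * expR (2 * K * t).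
    apply: (@picard_contraction x (u n) y (u n.+1) t) => //.
    - by rewrite divr_ge0 ?exprn_ge0 // mulr_ge0.
    - move=> s /andP[s0 _] j; rewrite mulrAC; exact: hx.
    - move=> j; apply: derivable_within_continuous => s; rewrite in_itv /=.
      by case/andP=> s0 _; have [] := dy s j s0.
    - by move=> s j /andP[s0 _]; apply: dy; exact: ltW.
    - by move=> s j /andP[s0 _]; apply: du; exact: ltW.
    - by rewrite y0 u0.
    - by rewrite t0 lexx.
  have h2 := hx t t0 k n.+1; rewrite -/D in h2.
  have e1 : 2 * C / 2 ^+ n / 2 * expR (2 * K * t) = D / 2 ^+ n / 2.
    by rewrite /D; ring.
  have e2 : D / 2 ^+ n.+1 = D / 2 ^+ n / 2.
    by rewrite exprS; field; rewrite expf_neq0.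
  rewrite e1 in h1; rewrite e2 in h2.
  have : `|y t k - x t k| <= `|y t k - u n.+1 t k| + `|x t k - u n.+1 t k|.
    by rewrite (distrC (x t k) (u n.+1 t k)) ler_distD.
  move: hn h1 h2 d0; lra.
exists y; split => // t k t0; rewrite (yx t t0); exact: dy.
Qed.

End PicardLindelof.

(** * Energy dissipation along positive solutions *)

Definition clamp (R : realType) (a b t : R) : R := Num.min (Num.max t a) b.

Section Clamp.
Variables (R : realType) (a b : R).
Hypothesis ab : a <= b.

Lemma clamp_itv t : a <= clamp a b t <= b.
Proof. by rewrite /clamp ge_min lexx orbT le_min le_max lexx orbT ab. Qed.

Lemma clamp_id t : a <= t <= b -> clamp a b t = t.
Proof. by move=> /andP[ta tb]; rewrite /clamp (max_l ta) (min_l tb). Qed.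

Lemma clamp_lip t s : `|clamp a b t - clamp a b s| <= `|t - s|.
Proof.
have main (x y : R) : x <= y -> 0 <= clamp a b y - clamp a b x <= y - x.
  move=> xy; rewrite /clamp.
  case: (leP x a) => ?; case: (leP y a) => ?; case: (leP a b) => ?;
    case: (leP x b) => ?; case: (leP y b) => ?; lra.
have [/main|/ltW/main] := leP t s.
  by move=> h; rewrite distrC [leRHS]distrC !ger0_norm; lra.
by move=> h; rewrite !ger0_norm; lra.
Qed.

Lemma continuous_clamp : continuous (clamp a b).
Proof.
move=> t; apply/cvgrPdist_le => e e0.
have : \forall s \near t, `|t - s| <= e.
  by have /cvgrPdist_le := @cvg_id _ (nbhs t); apply.
by apply: filterS => s; apply: le_trans (clamp_lip _ _).
Qed.

Lemma clamp_continuous (f : R -> R) :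
  {within `[a, b], continuous f} -> continuous (f \o clamp a b).
Proof.
move=> /subspace_continuousP cf t.
have inI s : `[a, b]%classic (clamp a b s) by rewrite /= in_itv /= clamp_itv.
apply: cvg_comp (cf _ (inI t)) => P; rewrite /within /= => hP.
have h : \forall s \near t, `[a, b]%classic (clamp a b s) -> P (clamp a b s).
  exact: (@continuous_clamp t _ hP).
by apply: filterS h => s; apply; exact: inI.
Qed.

Lemma within_of_clamp (f : R -> R) :
  continuous (f \o clamp a b) -> {within `[a, b], continuous f}.
Proof.
move=> cf; apply: (@subspace_eq_continuous _ _ _ (f \o clamp a b)).
  by move=> t; rewrite inE /= in_itv /= => /clamp_id ->.
exact: continuous_subspaceT.
Qed.
End Clamp.

Lemma is_derive_bigsum (R : realType) (I : finType) (f : I -> R -> R)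
    (df : I -> R) (t : R) :
  (forall k, is_derive t (1 : R) (f k) (df k)) ->
  is_derive t (1 : R) (fun s => \sum_k f k s) (\sum_k df k).
Proof.
move=> hf.
suff gen (r : seq I) : is_derive t (1 : R) (fun s => \sum_(k <- r) f k s)
    (\sum_(k <- r) df k) by exact: gen.
elim: r => [|i r IHr].
  under eq_fun do rewrite big_nil; rewrite big_nil; exact: is_derive_cst.
under eq_fun do rewrite big_cons; rewrite big_cons; exact: is_deriveD.
Qed.

Lemma continuous_bigsum (R : realType) (I : finType) (f : I -> R -> R) :
  (forall k, continuous (f k)) -> continuous (fun s => \sum_k f k s).
Proof.
move=> cf; apply: continuous_big; first exact: add_continuous.
by move=> k _; exact: cf.
Qed.

Section Solutions.
Variables (R : realType) (N : nat) (T : \bar R) (rho : R -> 'Z_N -> R).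
Hypothesis N1 : (1 < N)%N.
Hypothesis sol : positive_solution T rho.

Lemma solution_continuous (b : R) k : 0 < b -> (b%:E < T)%E ->
  {within `[0, b], continuous (fun t => rho t k)}.
Proof.
move=> b0 bT; have [_ d0 dt] := sol.
have ct (t : R) : 0 < t -> t <= b -> {for t, continuous (fun s => rho s k)}.
  move=> t0 tb; apply: differentiable_continuous; apply/derivable1_diffP.
  have tT : (t%:E < T)%E by apply: le_lt_trans bT; rewrite lee_fin.
  by have [] := dt t k t0 tT.
apply/continuous_within_itvP => //; split.
- by move=> t; rewrite in_itv /= => /andP[t0 tb]; apply: ct => //; exact: ltW.
- have h1 : h * (h^-1 * (rho h k - rho 0 k)) @[h --> 0^'+] --> 0 * dlss_field (rho 0) k.
    by apply: cvgM (d0 k); apply: cvg_at_right_filter; exact: cvg_id.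
  have h2 : rho 0 k + h * (h^-1 * (rho h k - rho 0 k)) @[h --> 0^'+] --> rho 0 k + 0 * dlss_field (rho 0) k.
    by apply: cvgD h1; exact: cvg_cst.
  rewrite mul0r addr0 in h2.
  apply: cvg_trans h2; apply: near_eq_cvg.
  near=> h.
  have hn0 : h != 0 by rewrite gt_eqF //; near: h; exact: nbhs_right_gt.
  by rewrite mulVKf // addrC subrK.
- apply: cvg_at_left_filter; exact: ct.
Unshelve. all: by end_near. Qed.

Lemma log_functional_derive (t : R) : 0 < t -> (t%:E < T)%E ->
  is_derive t (1 : R) (fun s => log_functional (rho s))
    (- (mesh R N * \sum_k dlss_field (rho t) k / rho t k)).
Proof.
move=> t0 tT; have [dens _ dt] := sol.
have [pos _] := dens t (ltW t0) tT.
apply: is_deriveN; apply: is_deriveZ; apply: is_derive_bigsum => k.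
have h := @is_derive1_comp R (@ln R) (fun s => rho s k) t _ _
  (is_derive1_ln (pos k)) (dt t k t0 tT).
by apply: (is_derive_eq h); rewrite mulrC.
Qed.

Section Energy.
Variable b : R.
Hypotheses (b0 : 0 < b) (bT : (b%:E < T)%E).

(** Clamping time to [[0, b]] extends the solution to a continuous positive curve on the
    whole line. *)
Let clamped (t : R) := rho (clamp 0 b t).

Let clamped_pos t k : 0 < clamped t k.
Proof.
have /andP[h0 hb] := clamp_itv (ltW b0) t.
have [dens _ _] := sol; have [|pos _] := dens _ h0; last exact: pos.
by apply: le_lt_trans bT; rewrite lee_fin.
Qed.

Let clamped_ln k : continuous (fun t => ln (clamped t k)).
Proof.
move=> t; apply: (@continuous_comp _ _ _ (fun t => clamped t k) (@ln R)).
  exact: (clamp_continuous (ltW b0) (solution_continuous b0 bT)).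
exact: continuous_ln (clamped_pos t k).
Qed.

Let clamped_log_functional : continuous (fun t => log_functional (clamped t)).
Proof.
rewrite /log_functional => t; apply: cvgN; apply: cvgM; first exact: cvg_cst.
by apply: continuous_bigsum => k; exact: clamped_ln.
Qed.

Let clamped_log_dissipation : continuous (fun t => log_dissipation (clamped t)).
Proof.
rewrite /log_dissipation => t; apply: cvgM; first exact: cvg_cst.
apply: continuous_bigsum => k {}t.
apply: (@continuous_comp _ _ _ (fun s => `|dlap (fun j => ln (clamped s j)) k|)
  (fun x : R => x ^+ 2)); last exact: exprn_continuous.
apply: (@continuous_comp _ _ _ (fun s => dlap (fun j => ln (clamped s j)) k) Num.norm);
  last exact: norm_continuous.
rewrite /dlap; apply: cvgM; last exact: cvg_cst.
apply: cvgB; first by apply: cvgD; exact: clamped_ln.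
by apply: cvgM; [exact: cvg_cst|exact: clamped_ln].
Qed.

Lemma log_dissipation_continuous :
  {within `[0, b], continuous (fun t => log_dissipation (rho t))}.
Proof. exact: (@within_of_clamp R 0 b (fun t => log_dissipation (rho t)) clamped_log_dissipation). Qed.

Lemma log_functional_continuous :
  {within `[0, b], continuous (fun t => log_functional (rho t))}.
Proof. exact: (@within_of_clamp R 0 b (fun t => log_functional (rho t)) clamped_log_functional). Qed.

Lemma log_dissipation_ge0 (r : 'Z_N -> R) : 0 <= log_dissipation r.
Proof.
rewrite /log_dissipation mulr_ge0 ?invr_ge0 //.
by apply: sumr_ge0 => k _; exact: sqr_ge0.
Qed.

Lemma log_functional_slope (t : R) : 0 < t < b ->
  - (mesh R N * \sum_k dlss_field (rho t) k / rho t k)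
    <= - (2^-1 * log_dissipation (rho t)).
Proof.
move=> /andP[t0 tb]; rewrite lerN2; apply: entropy_production => // k.
have [dens _ _] := sol; have [|pos _] := dens _ (ltW t0); last exact: pos.
by apply: lt_trans bT; rewrite lte_fin.
Qed.

(** [J] is the increment over [[0, b]] of a primitive of the dissipation; the
    functional plus half of that primitive has a nonpositive derivative. *)
Lemma energy_dissipation : exists J : R,
  (\int[lebesgue_measure]_(s in `[0%R, b]) (log_dissipation (rho s))%:E = J%:E)%E
  /\ log_functional (rho b) + 2^-1 * J <= log_functional (rho 0).
Proof.
pose g t := log_dissipation (clamped t).
have gE t : 0 <= t <= b -> g t = log_dissipation (rho t).
  by move=> tb; rewrite /g /clamped clamp_id.
have cg : continuous (fun t => g (clamp0 t)).
  move=> t; apply: (@continuous_comp _ _ _ (@clamp0 R) g).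
    exact: continuous_clamp0.
  exact: clamped_log_dissipation.
have [G [G0 dG]] := primitive_exists cg.
have cG : {within `[0, b], continuous G}.
  apply: derivable_within_continuous => t; rewrite in_itv /= => /andP[t0 _].
  by have [] := dG t t0.
exists (G b); split.
  transitivity (\int[lebesgue_measure]_(s in `[0%R, b]) (g s)%:E)%E.
    by apply: eq_integral => s; rewrite inE /= in_itv /= => /gE ->.
  rewrite (@continuous_FTC2 _ g G 0 b) ?G0 ?sube0 //.
  - apply: continuous_subspaceT; exact: clamped_log_dissipation.
  - have [cG1 cG2 cG3] := (continuous_within_itvP G b0).1 cG.
    split => // t; rewrite in_itv /= => /andP[t0 _].
    by have [] := dG t (ltW t0).
  - move=> t; rewrite in_itv /= => /andP[t0 _].
    by rewrite derive1E; have /@derive_val -> := dG t (ltW t0).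
have cG2 : {within `[0, b], continuous (fun t => - (2^-1 * G t))}.
  by move=> t; apply: cvgN; apply: cvgM; [exact: cvg_cst|exact: cG].
have := @le_of_derive R (fun t => log_functional (rho t)) (fun t => - (2^-1 * G t))
  _ (fun t => - (2^-1 * g t)) 0 b (ltW b0) log_functional_continuous cG2.
move=> /(_ (fun t => - (mesh R N * \sum_k dlss_field (rho t) k / rho t k))).
rewrite G0 mulr0 oppr0 subr0 => h.
suff : log_functional (rho b) - log_functional (rho 0) <= - (2^-1 * G b) by lra.
apply: h => t tb; have /andP[t0 tb'] := tb.
- apply: log_functional_derive => //.
  by apply: lt_trans bT; rewrite lte_fin.
- apply: is_deriveN; apply: is_deriveZ; exact: dG (ltW t0).
- by rewrite gE ?(ltW t0) ?(ltW tb') //; exact: log_functional_slope.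
Qed.

Lemma log_functional_nincr (s : R) : 0 <= s <= b ->
  log_functional (rho b) <= log_functional (rho s).
Proof.
move=> /andP[s0 sb].
have sub : `[s, b] `<=` `[0, b].
  by move=> r /=; rewrite !in_itv /= => /andP[sr ->]; rewrite (le_trans s0).
have c1 : {within `[s, b], continuous (fun t => log_functional (rho t))}.
  exact: continuous_subspaceW sub log_functional_continuous.
have c0 : {within `[s, b], continuous (fun=> 0 : R)}.
  by move=> t; exact: cvg_cst.
have := @le_of_derive R (fun t => log_functional (rho t)) (fun=> 0)
  (fun t => - (mesh R N * \sum_k dlss_field (rho t) k / rho t k)) (fun=> 0) s b
  sb c1 c0.
rewrite subr0 subr_le0; apply=> t /andP[st tb].
- apply: log_functional_derive; first exact: le_lt_trans st.
  by apply: lt_trans bT; rewrite lte_fin.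
- apply: le_trans (log_functional_slope _) _; first by rewrite (le_lt_trans s0).
  by rewrite oppr_le0 mulr_ge0 // log_dissipation_ge0.
Qed.

End Energy.
End Solutions.

(** * Integrals and suprema of the oscillation *)

(** By definition the integral of a nonnegative function is a supremum over the
    simple functions below it, so monotonicity holds without measurability. *)
Lemma ge0_le_integral_of_le d (T : measurableType d) (R : realType)
    (mu : {measure set T -> \bar R}) (D : set T) (f g : T -> \bar R) :
  (forall x, D x -> 0 <= f x)%E -> (forall x, D x -> f x <= g x)%E ->
  (\int[mu]_(x in D) f x <= \int[mu]_(x in D) g x)%E.
Proof.
move=> f0 fg; rewrite integral_mkcond [leRHS]integral_mkcond.
have fg' x : ((f \_ D) x <= (g \_ D) x)%E.
  by rewrite !patchE; case: ifPn => // /set_mem; exact: fg.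
have f0' x : (0 <= (f \_ D) x)%E by apply: erestrict_ge0.
rewrite !ge0_integralTE // => [|x]; last exact: le_trans (f0' x) (fg' x).
by apply: ereal_sup_le => _ [h hf <-]; exists h => // x; exact: le_trans (hf x) (fg' x).
Qed.

Lemma log_osc2_ge0 (R : realType) (N : nat) (r : 'Z_N -> R) : 0 <= log_osc2 r.
Proof.
have [[h1 h2]|h] := pselect (has_sup [set x : R | exists k l : 'Z_N, x = `|ln (r k) - ln (r l)| ^+ 2]).
  rewrite /log_osc2; apply: (@le_trans _ _ (`|ln (r 0) - ln (r 0)| ^+ 2)).
    exact: sqr_ge0.
  by apply: sup_upper_bound => //; exists 0, 0.
by rewrite /log_osc2 sup_out.
Qed.

(** * The clamped vector field *)

Lemma sqrt_lip (R : realType) (c x y : R) : 0 < c -> c <= Num.sqrt x ->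
  c <= Num.sqrt y -> 0 <= x -> 0 <= y ->
  `|Num.sqrt x - Num.sqrt y| <= `|x - y| / (2 * c).
Proof.
move=> c0 cx cy x0 y0.
rewrite ler_pdivlMr ?mulr_gt0 //.
rewrite -{2}(sqr_sqrtr x0) -{2}(sqr_sqrtr y0) subr_sqr normrM.
rewrite ler_wpM2l // ger0_norm; first by lra.
by rewrite addr_ge0 ?sqrtr_ge0.
Qed.

Section TruncatedField.
Variables (R : realType) (N : nat) (c M : R).
Hypotheses (N1 : (1 < N)%N) (c0 : 0 < c) (cM : c <= M).

Definition truncated_field (r : 'Z_N -> R) : 'Z_N -> R :=
  dlss_field (fun k => clamp c M (r k)).

(** A Lipschitz constant for the maximum norm: [M / c] for the geometric means,
    1 for the subtracted component, and [8 = 2 * 4] from the prefactor of the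
    equation and the sum of the absolute values of the stencil [1, -2, 1]. *)
Definition truncated_lip : R := 8 / mesh R N ^+ 4 * (M / c + 1).

Lemma truncated_lip_gt0 : 0 < truncated_lip.
Proof.
have d0 : 0 < mesh R N by rewrite invr_gt0 ltr0n ltnW.
by rewrite /truncated_lip mulr_gt0 // ?divr_gt0 ?exprn_gt0 // addr_gt0 // divr_gt0 // (lt_le_trans c0).
Qed.

Lemma geometric_mean_lip (a b a' b' e : R) :
  c <= a <= M -> c <= b <= M -> c <= a' <= M -> c <= b' <= M ->
  `|a - a'| <= e -> `|b - b'| <= e ->
  `|Num.sqrt (a * b) - Num.sqrt (a' * b')| <= M / c * e.
Proof.
move=> /andP[ca aM] /andP[cb bM] /andP[ca' aM'] /andP[cb' bM'] he he'.
have sq (x y : R) : c <= x -> c <= y -> c <= Num.sqrt (x * y).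
  move=> cx cy; have -> : c = Num.sqrt (c * c).
    by rewrite -expr2 sqrtr_sqr ger0_norm // ltW.
  by rewrite ler_sqrt ?ler_pM ?mulr_ge0 ?(ltW c0) // (le_trans (ltW c0)).
have p (x : R) : c <= x -> 0 <= x by apply: le_trans; exact: ltW.
apply: (le_trans (sqrt_lip c0 (sq _ _ ca cb) (sq _ _ ca' cb') _ _)).
- by rewrite mulr_ge0 ?p.
- by rewrite mulr_ge0 ?p.
rewrite ler_pdivrMr ?mulr_gt0 //.
have -> : M / c * e * (2 * c) = M * e + M * e by field; rewrite gt_eqF.
have -> : a * b - a' * b' = (a - a') * b + a' * (b - b') by ring.
apply: (le_trans (ler_normD _ _)); rewrite !normrM.
rewrite lerD //.
  by rewrite mulrC ler_pM // ger0_norm ?p.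
by rewrite ler_pM // ger0_norm ?p.
Qed.

Lemma truncated_field_lip (x y : 'Z_N -> R) (e : R) :
  (forall j, `|x j - y j| <= e) ->
  forall k, `|truncated_field x k - truncated_field y k| <= truncated_lip * e.
Proof.
move=> xy k.
have d0 : 0 < mesh R N by rewrite invr_gt0 ltr0n ltnW.
pose q (z : 'Z_N -> R) j := clamp c M (z j).
pose w z j := (Num.sqrt (q z (j + 1) * q z (j - 1)) - q z j).
have qe j : `|q x j - q y j| <= e.
  by apply: le_trans (xy j); exact: clamp_lip.
pose L := (M / c + 1) * e.
have we j : `|w x j - w y j| <= L.
  rewrite /w /L mulrDl mul1r.
  have -> : forall s t s' t' : R, s - t - (s' - t') = (s - s') + (t' - t).
    by move=> *; ring.
  apply: (le_trans (ler_normD _ _)); apply: lerD; last by rewrite distrC.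
  by apply: geometric_mean_lip; rewrite ?clamp_itv.
have -> : truncated_field x k - truncated_field y k =
   - 2 / mesh R N ^+ 4 * ((w x (k + 1) - w y (k + 1))
     + (w x (k - 1) - w y (k - 1)) - 2 * (w x k - w y k)).
  rewrite /truncated_field /dlss_field /dlap /w /q.
  by field; rewrite gt_eqF.
have -> : truncated_lip * e = 2 / mesh R N ^+ 4 * (4 * L).
  by rewrite /truncated_lip /L; ring.
rewrite normrM ler_pM //.
  rewrite mulNr normrN ger0_norm // divr_ge0 // exprn_ge0 // ltW //.
move: (we (k + 1)) (we (k - 1)) (we k).
rewrite !ler_norml => /andP[? ?] /andP[? ?] /andP[? ?]; lra.
Qed.

Lemma truncated_field_id (r : 'Z_N -> R) :
  (forall k, c <= r k <= M) -> truncated_field r = dlss_field r.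
Proof.
move=> h; rewrite /truncated_field; congr dlss_field.
by apply/funext => k; rewrite clamp_id.
Qed.

End TruncatedField.

(** * Global existence and uniqueness *)

Lemma is_derive_cvg_right (R : realType) (f : R -> R) (df : R) :
  is_derive (0 : R) (1 : R) f df -> h^-1 * (f h - f 0) @[h --> 0^'+] --> df.
Proof.
move=> [hf <-].
have h1 : h^-1 *: ((f \o shift 0) (h *: (1 : R)) - f 0) @[h --> (0 : R)^'] --> 'D_1 f 0.
  exact: hf.
have h2 : h^-1 * (f h - f 0) @[h --> (0 : R)^'] --> 'D_1 f 0.
  apply: cvg_trans h1; apply: near_eq_cvg; near=> h.
  by rewrite /= /GRing.scale /= mulr1 addr0.
apply: cvg_trans h2; apply: cvg_app.
apply: within_subset => x /=; rewrite /= => x0; by rewrite gt_eqF.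
Unshelve. all: by end_near. Qed.

Section GlobalExistence.
Variables (R : realType) (N : nat) (rho0 : 'Z_N -> R).
Hypotheses (N1 : (1 < N)%N) (dens0 : pos_density rho0).

Let L0 := log_functional rho0.
(** By [pos_density_ge], no density whose logarithmic functional is at most that of
    [rho0] has a component below this value. *)
Definition density_floor : R := expR (- (N%:R * (log_functional rho0 + 1))).
Let c1 := density_floor.
(** Strictly below the floor [c1], so that staying above [c] is an open condition
    which the dissipation estimate improves to [c1]. *)
Let c := c1 / 2.

Let c1_gt0 : 0 < c1. Proof. exact: expR_gt0. Qed.
Let c_gt0 : 0 < c. Proof. by rewrite divr_gt0. Qed.
Let c_lt : c < c1. Proof. by rewrite /c; move: c1_gt0; lra. Qed.

Lemma ge_density_floor (r : 'Z_N -> R) k : pos_density r -> log_functional r <= L0 ->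
  c1 <= r k.
Proof. by move=> *; exact: pos_density_ge. Qed.

Let c_le_N : c <= N%:R.
Proof.
apply: le_trans (ltW c_lt) _; apply: (le_trans (ge_density_floor 0 dens0 (lexx _))).
exact: pos_density_le.
Qed.

Let F := @truncated_field R N c N%:R.
Let K := truncated_lip N c N%:R.

Lemma truncated_field_density (r : 'Z_N -> R) : pos_density r -> (forall k, c <= r k) ->
  F r = dlss_field r.
Proof.
by move=> dr cr; apply: truncated_field_id => k; rewrite cr pos_density_le.
Qed.

Section Flow.
Variable y : R -> 'Z_N -> R.
Hypothesis y0 : y 0 = rho0.
Hypothesis dy : forall (t : R) k, 0 <= t ->
  is_derive t (1 : R) (fun s => y s k) (F (y t) k).

Lemma flow_mass (t : R) : 0 <= t -> \sum_k y t k = N%:R.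
Proof.
move=> t0; have [_ mass] := dens0.
rewrite -(sum_pos_density N1 mass) -y0.
pose S s := \sum_k y s k.
have dS (s : R) : 0 <= s -> is_derive s (1 : R) S 0.
  move=> s0; apply: (is_derive_eq (is_derive_bigsum (fun k => dy k s0))).
  exact: sum_dlss_field.
have cS : {within `[0, t], continuous S}.
  apply: derivable_within_continuous => s; rewrite in_itv /= => /andP[s0 _].
  by have [] := dS s s0.
have c0 : {within `[0, t], continuous (fun=> 0 : R)}.
  by move=> s; exact: cvg_cst.
have dS' (s : R) : 0 < s < t -> is_derive s (1 : R) S 0.
  by move=> /andP[s0 _]; apply: dS; exact: ltW.
have d0 (s : R) : 0 < s < t -> is_derive s (1 : R) (fun=> 0 : R) 0.
  by move=> _; exact: is_derive_cst.
have h1 := le_of_derive t0 cS c0 dS' d0 (fun _ _ => lexx _).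
have h2 := le_of_derive t0 c0 cS d0 dS' (fun _ _ => lexx _).
by apply/eqP; rewrite eq_le -/(S t) -/(S 0); move: h1 h2; lra.
Qed.

Lemma flow_density (t : R) : 0 <= t -> (forall k, c <= y t k) -> pos_density (y t).
Proof.
move=> t0 cy; split; first by move=> k; apply: lt_le_trans (cy k).
by rewrite flow_mass // mulVf // pnatr_eq0 -lt0n ltnW.
Qed.

Lemma flow_solution (T : \bar R) : (0 < T)%E ->
  (forall t : R, 0 <= t -> (t%:E < T)%E -> forall k, c <= y t k) ->
  positive_solution T y.
Proof.
move=> T0 cy; have dens t t0 tT := flow_density t0 (cy t t0 tT).
split=> [t t0 tT|k|t k t0 tT]; first exact: dens.
  rewrite -(truncated_field_density (dens 0 (lexx _) T0) (cy 0 (lexx _) T0)).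
  by apply: is_derive_cvg_right; exact: dy.
rewrite -(truncated_field_density (dens t (ltW t0) tT) (cy t (ltW t0) tT)).
by apply: dy; exact: ltW.
Qed.

(** Staying above [c] before time [t] makes [y] a positive solution on [[0, t[], for
    which the monotone functional gives the better bound [c1]; it passes to [t] by
    continuity. *)
Lemma flow_floor_step (t : R) : 0 <= t ->
  (forall s : R, 0 <= s -> s < t -> forall k, c <= y s k) -> forall k, c1 <= y t k.
Proof.
move=> t0 cy k; have [tz|tz] := eqVneq t 0.
  by rewrite tz y0; apply: ge_density_floor.
have {tz} t0' : 0 < t by rewrite lt_neqAle eq_sym tz.
have sol : positive_solution t%:E y.
  by apply: flow_solution => [|s s0]; rewrite lte_fin // => st; exact: cy.
have c1y (s : R) : 0 < s -> s < t -> c1 <= y s k.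
  move=> s0 st; have [dens _ _] := sol.
  apply: ge_density_floor; first by apply: dens; rewrite ?lte_fin // ltW.
  rewrite /L0 -y0; apply: (@log_functional_nincr R N t%:E y N1 sol s).
  - exact: s0.
  - by rewrite lte_fin.
  - by rewrite lexx ltW.
have cyt : {for t, continuous (fun s => y s k)}.
  apply: differentiable_continuous; apply/derivable1_diffP.
  by have [] := dy k t0.
have cl : y s k @[s --> t^'-] --> y t k by apply: cvg_at_left_filter; exact: cyt.
rewrite leNgt; apply/negP => bad.
near t^'- => s.
have h1 : y s k < c1 by near: s; exact: cvgr_lt _ cl _ bad.
have h2 : 0 < s by near: s; exact: nbhs_left_gt.
have h3 : s < t by near: s; exact: nbhs_left_lt.
by move: (c1y s h2 h3); rewrite leNgt h1.
Unshelve. all: by end_near. Qed.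

(** At the infimum [tau] of the times where some component is below [c], all
    components are still at least [c1 > c], hence at least [c] a little longer. *)
Lemma flow_floor (t : R) : 0 <= t -> forall k, c <= y t k.
Proof.
move=> t0 k; rewrite leNgt; apply/negP => bad.
pose A := [set s : R | 0 <= s /\ exists k, y s k < c].
have At : A t by split => //; exists k.
have lbA : has_inf A by split; [exists t|exists 0 => s []].
pose tau := inf A.
have tau0 : 0 <= tau by apply: lb_le_inf; [exists t|move=> s []].
have before (s : R) : 0 <= s -> s < tau -> forall k, c <= y s k.
  move=> s0 st j; rewrite leNgt; apply/negP => b.
  have : tau <= s by apply: ge_inf; [exact: lbA.2|split => //; exists j].
  by rewrite leNgt st.
have at_tau := flow_floor_step tau0 before.
have [e e0 after] : exists2 e : R, 0 < e &
    forall s : R, tau <= s -> s < tau + e -> forall j, c <= y s j.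
  have near1 j : \forall s \near tau, c <= y s j.
    have cyt : {for tau, continuous (fun s => y s j)}.
      apply: differentiable_continuous; apply/derivable1_diffP.
      by have [] := dy j tau0.
    have : c < y tau j by apply: lt_le_trans (at_tau j).
    by move=> h; exact: cvgr_ge _ cyt _ h.
  have allnear : \forall s \near tau, forall j, c <= y s j.
    exact: filter_forall near1.
  have /nbhs_ballP[e /= e0 he] := allnear; exists e => // s ts se j.
  by apply: he; rewrite /ball /= ltr_norml; lra.
have : tau + e <= tau.
  apply: lb_le_inf; first by exists t.
  move=> s [s0 [j b]]; rewrite leNgt; apply/negP => se.
  have [st|st] := ltP s tau.
    by move: b; rewrite ltNge before.
  by move: b; rewrite ltNge after.
by rewrite gerDl leNgt e0.
Qed.
End Flow.

Lemma global_solution : exists y : R -> 'Z_N -> R,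
  y 0 = rho0 /\ positive_solution +oo%E y.
Proof.
have [y [y0 dy]] := @picard_lindelof R _ F K (truncated_lip_gt0 N1 c_gt0 c_le_N)
  (truncated_field_lip N1 c_gt0 c_le_N) rho0.
exists y; split=> //; apply: flow_solution => // t t0 _; exact: flow_floor.
Qed.

Lemma solution_floor (y : R -> 'Z_N -> R) : positive_solution +oo%E y ->
  y 0 = rho0 -> forall (t : R), 0 <= t -> forall k, c <= y t k.
Proof.
move=> sol y0 t t0 k; have [dens _ _] := sol.
apply: (le_trans (ltW c_lt)); apply: ge_density_floor; first by apply: dens => //; rewrite ltry.
have [->|tz] := eqVneq t 0; first by rewrite y0.
have t0' : 0 < t by rewrite lt_neqAle eq_sym tz.
rewrite /L0 -y0; apply: (@log_functional_nincr R N +oo%E y N1 sol t t0').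
  by rewrite ltry.
by rewrite lexx.
Qed.

(** Densities have components in [[0, N]], which starts the iteration of the
    contraction estimate; it then bounds the distance by [N exp (2 K s) / 2 ^ n]
    for all [n]. *)
Lemma solution_unique (y z : R -> 'Z_N -> R) :
  positive_solution +oo%E y -> positive_solution +oo%E z ->
  y 0 = rho0 -> z 0 = rho0 -> forall t : R, 0 <= t -> y t = z t.
Proof.
move=> soly solz y0 z0 t t0.
have [->|tz] := eqVneq t 0; first by rewrite y0 z0.
have t0' : 0 < t by rewrite lt_neqAle eq_sym tz.
have K0 := truncated_lip_gt0 N1 c_gt0 c_le_N.
have [dy _ gy] := soly; have [dz _ gz] := solz.
have fy (s : R) k : 0 < s < t -> is_derive s (1 : R) (fun r => y r k) (F (y s) k).
  move=> /andP[s0 _]; rewrite truncated_field_density; first by apply: gy => //; rewrite ltry.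
    by apply: dy; rewrite ?ltry // ltW.
  by apply: solution_floor => //; exact: ltW.
have fz (s : R) k : 0 < s < t -> is_derive s (1 : R) (fun r => z r k) (F (z s) k).
  move=> /andP[s0 _]; rewrite truncated_field_density; first by apply: gz => //; rewrite ltry.
    by apply: dz; rewrite ?ltry // ltW.
  by apply: solution_floor => //; exact: ltW.
have close n : forall s : R, 0 <= s <= t -> forall k,
    `|y s k - z s k| <= N%:R / 2 ^+ n * expR (2 * K * s).
  elim: n => [|n IHn].
    move=> s /andP[s0 _] k; rewrite expr0 divr1.
    apply: (@le_trans _ _ N%:R); last first.
      rewrite ler_peMr // (le_trans _ (expR_ge1Dx _)) // lerDl.
      by apply: mulr_ge0 => //; apply: mulr_ge0 => //; exact: ltW.
    have ys : pos_density (y s) by apply: dy; rewrite ?ltry.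
    have zs : pos_density (z s) by apply: dz; rewrite ?ltry.
    have := pos_density_le k N1 ys; have := pos_density_le k N1 zs.
    have := ys.1 k; have := zs.1 k; rewrite ler_norml; lra.
  have -> : N%:R / 2 ^+ n.+1 = N%:R / 2 ^+ n / 2 :> R.
    by rewrite exprS; field; rewrite expf_neq0.
  apply: (@picard_contraction R _ F K (truncated_field_lip N1 c_gt0 c_le_N) y z y z t) => //.
  - by move=> k; apply: (solution_continuous soly) => //; rewrite ltry.
  - by move=> k; apply: (solution_continuous solz) => //; rewrite ltry.
  - by rewrite y0 z0.
apply/funext => k; apply/eqP; rewrite -subr_eq0 -normr_le0 leNgt; apply/negP => d0.
have d2 : 0 < `|y t k - z t k| / 2 by rewrite divr_gt0.
have [n hn] := exists_half_pow_le (N%:R * expR (2 * K * t)) d2.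
have := close n t; rewrite t0 lexx => /(_ isT k); rewrite mulrAC.
by move: hn d0; lra.
Qed.

End GlobalExistence.

Unset Implicit Arguments.

Theorem lemma16 (R : realType) (N : nat) (hN : (2 <= N)%N) :
  (forall (T : \bar R) (rho : R -> 'Z_N -> R),
     (0 < T)%E -> positive_solution T rho ->
     (forall s t : R, 0 <= s -> s <= t -> (t%:E < T)%E ->
        log_functional (rho t) <= log_functional (rho s)) /\
     (forall t : R, 0 < t -> (t%:E < T)%E ->
        ((log_functional (rho t))%:E
         + (2^-1)%:E * \int[lebesgue_measure]_(s in `[0%R, t])
                          (log_dissipation (rho s))%:E
         <= (log_functional (rho 0%R))%:E)%E)) /\
  (forall rho0 : 'Z_N -> R, pos_density rho0 ->
     exists rho : R -> 'Z_N -> R,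
       [/\ positive_solution +oo%E rho,
           rho 0 = rho0,
           forall rho' : R -> 'Z_N -> R,
             positive_solution +oo%E rho' -> rho' 0 = rho0 ->
             forall t : R, 0 <= t -> rho' t = rho t &
           forall t : R, 0 < t ->
             (\int[lebesgue_measure]_(s in `[0%R, t]) (log_osc2 (rho s))%:E
              <= (C_PI R N / 2 * log_functional rho0)%:E)%E]).
Proof.
split=> [T rho T0 sol|rho0 dens0].
  split=> [s t s0 st tT|t t0 tT].
    have [tz|tz] := eqVneq t 0.
      by have -> : s = t by apply/eqP; rewrite eq_le st tz.
    have t0 : 0 < t by rewrite lt_neqAle eq_sym tz (le_trans s0).
    by apply: (log_functional_nincr hN sol t0 tT); rewrite s0.
  have [J [-> h]] := energy_dissipation hN sol t0 tT.
  by rewrite -EFinM -EFinD lee_fin.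
have [rho [rho_0 sol]] := global_solution hN dens0.
exists rho; split=> // [rho' sol' rho'_0 t t0|t t0].
  exact: (solution_unique hN dens0 sol' sol).
have tT : (t%:E < +oo)%E by rewrite ltry.
have [J [EJ h]] := energy_dissipation hN sol t0 tT.
have [dens _ _] := sol.
have Lt0 := log_functional_ge0 hN (dens t (ltW t0) tT).
have C0 : 0 <= C_PI R N / 4.
  apply: divr_ge0 => //; apply: divr_ge0; first exact: sqr_ge0.
  by apply: mulr_ge0 => //; rewrite subr_ge0 cos_le1.
apply: (@le_trans _ _ (\int[lebesgue_measure]_(s in `[0%R, t])
    ((C_PI R N / 4)%:E * (log_dissipation (rho s))%:E))%E).
  apply: ge0_le_integral_of_le => s _; first by rewrite lee_fin log_osc2_ge0.
  by rewrite -EFinM lee_fin log_osc2_le.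
rewrite ge0_integralZl_EFin //; last 2 first.
- by move=> s _; rewrite lee_fin log_dissipation_ge0.
- apply/measurable_EFinP; apply: subspace_continuous_measurable_fun => //.
  exact: (log_dissipation_continuous sol t0 tT).
rewrite EJ -EFinM lee_fin.
have -> : C_PI R N / 2 * log_functional rho0 = C_PI R N / 4 * (2 * log_functional rho0).
  by field.
by rewrite ler_wpM2l // -rho_0; lra.
Qed.
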